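(* Let the standing assumption (A) hold with $p\ge2$. Then every minimizer $(\bar\alpha_1,\bar\alpha_2)\in L^1(\Omega_1)\times L^1(\Omega_2)$ of problem (P$^\dagger$) satisfies $\bar\alpha_i\in L^q(\Omega_i)$ for $i=1,2$.
   Context: Standing assumption (A): $\Omega_1,\Omega_2\subset\mathbb{R}^n$ are compact, $\Omega:=\Omega_1\times\Omega_2$, $c:\Omega\to\mathbb{R}$ is continuous with $c\ge c^\dagger>-\infty$, $\gamma>0$, $p>1$ and $q$ is its conjugate exponent ($1/p+1/q=1$), and $\mu_i\in L^p(\Omega_i)$ satisfy $\mu_i\ge\delta>0$ a.e. and $\int_{\Omega_i}\mu_i\,dx=1$ for $i=1,2$. Problem (P$^\dagger$) is: minimize $\Lambda(\alpha_1,\alpha_2):=\frac1q\|(\alpha_1\oplus\alpha_2-c)_+\|_{L^q(\Omega)}^q-\gamma^{q-1}\int_{\Omega_1}\alpha_1\mu_1\,dx-\gamma^{q-1}\int_{\Omega_2}\alpha_2\mu_2\,dx$ over all $\alpha_i\in L^1(\Omega_i)$, $i=1,2$, with $(\alpha_1\oplus\alpha_2-c)_+/\gamma\in L^q(\Omega)$, where $(\alpha_1\oplus\alpha_2)(x_1,x_2):=\alpha_1(x_1)+\alpha_2(x_2)$ and $t_+=\max(t,0)$. *)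

(* Defs.v *)
From HB Require Import structures.
From mathcomp Require Import all_boot all_order all_algebra.
From mathcomp Require Import all_classical all_reals all_analysis.
Set Implicit Arguments. Unset Strict Implicit. Unset Printing Implicit Defensive.
Import Order.TTheory GRing.Theory Num.Theory.
Import numFieldNormedType.Exports.
Local Open Scope classical_set_scope.
Local Open Scope ring_scope.

Definition Rn_display : measure_display. Proof. exact: default_measure_display. Qed.

Section Rn_measurable.
Context (R : realType).

Definition Rn (n : nat) : Type := 'rV[R]_n.

HB.instance Definition _ n := NormedModule.copy (Rn n) 'rV[R]_n.

Definition Rn_coor n (i : 'I_n) (v : Rn n) : R := v ord0 i.

Let Rn_set0 n : g_sigma_preimage (@Rn_coor n) set0.
Proof. exact: sigma_algebra0. Qed.
Let Rn_setC n A : g_sigma_preimage (@Rn_coor n) A ->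
  g_sigma_preimage (@Rn_coor n) (~` A).
Proof. exact: sigma_algebraC. Qed.
Let Rn_bigcup n (F : _^nat) : (forall i, g_sigma_preimage (@Rn_coor n) (F i)) ->
  g_sigma_preimage (@Rn_coor n) (\bigcup_i (F i)).
Proof. exact: sigma_algebra_bigcup. Qed.

(* Borel sigma-algebra of R^n = sigma-algebra generated by the coordinates *)
HB.instance Definition _ n := @isMeasurable.Build Rn_display
  (Rn n) (g_sigma_preimage (@Rn_coor n)) (@Rn_set0 n) (@Rn_setC n) (@Rn_bigcup n).

End Rn_measurable.


Section Rn_measurable_fun.
Context (R : realType).

Lemma measurable_Rn_coor n (i : 'I_n) :
  measurable_fun [set: Rn R n] (@Rn_coor R n i).
Proof.
move=> _ Y mY; rewrite setTI; apply: sub_sigma_algebra => /=.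
rewrite -bigcup_seq/=; exists i => /=; first by rewrite mem_index_enum.
by exists Y => //; rewrite setTI.
Qed.

Lemma measurable_fun_RnP d1 (T1 : measurableType d1) n (f : T1 -> Rn R n) :
  measurable_fun [set: T1] f <->
  forall i, measurable_fun [set: T1] (@Rn_coor R n i \o f).
Proof.
apply: (@iff_trans _ (g_sigma_preimage
    (fun i => @Rn_coor R n i \o f) `<=` measurable)).
  rewrite g_sigma_preimage_comp; split=> [mf A [/= C preC <-]|prefS].
    exact: mf.
  by move=> _ A mA; apply: prefS; exists A.
split=> [tnthfS i|mf].
- move=> _ A mA.
  apply: tnthfS; apply: sub_sigma_algebra.
  case: n i => [[] []//|n i] in f *.
  rewrite -bigcup_mkord_ord.
  exists i; first exact: ltn_ord.
  by exists A => //; rewrite inord_val.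
- apply: smallest_sub; first exact: sigma_algebra_measurable.
  case: n => [|n] in f mf *; first by rewrite big_ord0.
  rewrite -bigcup_mkord_ord; apply: bigcup_sub => i Ii.
  by move=> A [B mB <-]; exact: mf.
Qed.

Definition Rn_merge m (p : R * Rn R m) : Rn R m.+1 :=
  row_mx (const_mx p.1 : 'rV[R]_1) (p.2 : 'rV[R]_m).
Definition Rn_split m (v : Rn R m.+1) : R * Rn R m :=
  (v ord0 ord0, rsubmx (v : 'rV[R]_(1 + m))).

Lemma Rn_mergeK m : cancel (@Rn_merge m) (@Rn_split m).
Proof.
move=> [a v]; rewrite /Rn_split /Rn_merge /=; congr (_, _); last first.
  by rewrite row_mxKr.
rewrite mxE; case: splitP => [j _|j /= ij]; first by rewrite mxE.
by exfalso; move: ij; rewrite add1n.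
Qed.

Lemma measurable_Rn_merge m : measurable_fun [set: R * Rn R m] (@Rn_merge m).
Proof.
apply/measurable_fun_RnP => i /=.
rewrite /Rn_coor /Rn_merge /comp.
case: (splitP (i : 'I_(1 + m))) => j ij.
- have -> : (fun x : R * Rn R m => row_mx (const_mx x.1 : 'rV[R]_1) x.2 ord0 i) = fst.
    apply/funext => x; rewrite mxE; case: splitP => [k _|k ik]; first by rewrite mxE.
    by exfalso; move: ik (ltn_ord j); rewrite ij => ->.
  exact: measurable_fst.
- have -> : (fun x : R * Rn R m => row_mx (const_mx x.1 : 'rV[R]_1) x.2 ord0 i)
      = @Rn_coor R m j \o snd.
    apply/funext => x; rewrite mxE; case: splitP => [k /= ik|k /= ik].
      by exfalso; move: ik (ltn_ord k); rewrite ij => <-.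
    by rewrite /comp /Rn_coor; congr (x.2 ord0 _); apply/val_inj; move: ik; rewrite ij => -[].
  exact: (measurableT_comp (measurable_Rn_coor j) measurable_snd).
Qed.

Lemma measurable_Rn_split m : measurable_fun [set: Rn R m.+1] (@Rn_split m).
Proof.
apply: measurable_fun_pair; first exact: (measurable_Rn_coor ord0).
apply/measurable_fun_RnP => j; rewrite /comp /Rn_coor.
under eq_fun do rewrite mxE.
exact: (measurable_Rn_coor (rshift 1 j)).
Qed.

End Rn_measurable_fun.

Section lebesgue_Rn_construction.
Local Open Scope ereal_scope.
Context (R : realType).

(* R^0 is a point: Lebesgue measure on R^0 is the Dirac mass *)
Definition lebRn0 : set (Rn R 0) -> \bar R := @dirac _ (Rn R 0) (0%R : 'rV[R]_0) R.
HB.instance Definition _ := Measure.copy lebRn0 (@dirac _ (Rn R 0) (0%R : 'rV[R]_0) R).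

Let lebRn0_sigma_finite : sigma_finite [set: Rn R 0] lebRn0.
Proof.
exists (fun=> setT); first by rewrite bigcup_const.
by move=> _; split => //; rewrite /lebRn0 diracT ltry.
Qed.

HB.instance Definition _ := Measure_isSigmaFinite.Build _ _ _ lebRn0
  lebRn0_sigma_finite.

Section succ.
Context m (mu : {sigma_finite_measure set (Rn R m) -> \bar R}).

Definition lebRn_succ : set (Rn R m.+1) -> \bar R :=
  pushforward ((@lebesgue_measure R) \x mu) (@Rn_merge R m).

Let lebRn_succ0 : lebRn_succ set0 = 0.
Proof. by rewrite /lebRn_succ /pushforward preimage_set0 measure0. Qed.

Let lebRn_succ_ge0 A : 0 <= lebRn_succ A.
Proof. by rewrite /lebRn_succ /pushforward; exact: measure_ge0. Qed.

Let lebRn_succ_sigma_additive : semi_sigma_additive lebRn_succ.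
Proof.
have mf := @measurable_Rn_merge R m.
move=> F mF tF mUF; rewrite /lebRn_succ /pushforward preimage_bigcup.
apply: measure_semi_sigma_additive.
- by move=> n; rewrite -[X in measurable X]setTI; exact: mf.
- apply/trivIsetP => /= i j _ _ ij; rewrite -preimage_setI.
  by move/trivIsetP : tF => /(_ _ _ _ _ ij) ->//; rewrite preimage_set0.
- by rewrite -preimage_bigcup -[X in measurable X]setTI; exact: mf.
Qed.

HB.instance Definition _ := isMeasure.Build _ _ _
  lebRn_succ lebRn_succ0 lebRn_succ_ge0 lebRn_succ_sigma_additive.


Let prod_sigma_finite : sigma_finite [set: R * Rn R m] ((@lebesgue_measure R) \x mu).
Proof.
have /sigma_finiteP[F [TF ndF Foo]] := sigma_finiteT (@lebesgue_measure R).
have /sigma_finiteP[G [TG ndG Goo]] := sigma_finiteT mu.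
exists (fun n => F n `*` G n).
 rewrite -setXTT TF TG predeqE => -[x y]; split.
    move=> [/= [n _ Fnx] [k _ Gky]]; exists (maxn n k) => //; split.
    - by move: x Fnx; exact/subsetPset/ndF/leq_maxl.
    - by move: y Gky; exact/subsetPset/ndG/leq_maxr.
  by move=> [n _ []/= ? ?]; split; exists n.
move=> k; have [? ?] := Foo k; have [? ?] := Goo k.
split; first exact: measurableX.
by rewrite product_measure1E// lte_mul_pinfty// ge0_fin_numE.
Qed.

Let lebRn_succ_sigma_finite : sigma_finite [set: Rn R m.+1] lebRn_succ.
Proof.
have [F TF mF] := prod_sigma_finite.
exists (fun k => @Rn_split R m @^-1` F k).
  by rewrite -preimage_bigcup -TF preimage_setT.
move=> k; split.
  rewrite -[X in measurable X]setTI.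
  exact: (measurable_Rn_split measurableT (mF k).1).
rewrite /lebRn_succ /pushforward -comp_preimage.
have -> : @Rn_split R m \o @Rn_merge R m = id by apply/funext => x; rewrite /= Rn_mergeK.
by rewrite preimage_id; exact: (mF k).2.
Qed.

HB.instance Definition _ := Measure_isSigmaFinite.Build _ _ _ lebRn_succ
  lebRn_succ_sigma_finite.

End succ.

Definition lebRn_succ_sf m (mu : {sigma_finite_measure set (Rn R m) -> \bar R}) :
  {sigma_finite_measure set (Rn R m.+1) -> \bar R} := lebRn_succ mu.

Fixpoint lebesgue_Rn (n : nat) : {sigma_finite_measure set (Rn R n) -> \bar R} :=
  match n with
  | 0 => lebRn0
  | m.+1 => lebRn_succ_sf (lebesgue_Rn m)
  end.

End lebesgue_Rn_construction.

Arguments lebesgue_Rn {R} n.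

Section problem_P_dagger.
Local Open Scope ereal_scope.
Context (R : realType).

Definition inLp d (T : measurableType d) (mu : {measure set T -> \bar R})
    (D : set T) (p : R) (f : T -> R) : Prop :=
  measurable_fun D f /\ \int[mu]_(x in D) (`|f x| `^ p)%R%:E < +oo.

Variable n : nat.
Local Notation leb := (@lebesgue_Rn R n).
Local Notation leb2 := (leb \x leb).

Definition oplus_pos (c : Rn R n * Rn R n -> R) (a1 a2 : Rn R n -> R)
    (z : Rn R n * Rn R n) : R :=
  (Num.max (a1 z.1 + a2 z.2 - c z) 0)%R.

Definition Pdag_admissible (Om1 Om2 : set (Rn R n)) (c : Rn R n * Rn R n -> R)
    (gamma q : R) (a1 a2 : Rn R n -> R) : Prop :=
  [/\ inLp leb Om1 1 a1, inLp leb Om2 1 a2 &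
      inLp leb2 (Om1 `*` Om2) q (fun z => oplus_pos c a1 a2 z / gamma)%R].

Definition Pdag_Lambda (Om1 Om2 : set (Rn R n)) (c : Rn R n * Rn R n -> R)
    (gamma q : R) (mu1 mu2 : Rn R n -> R) (a1 a2 : Rn R n -> R) : \bar R :=
  (q^-1)%R%:E * \int[leb2]_(z in Om1 `*` Om2) ((oplus_pos c a1 a2 z) `^ q)%R%:E
  - (gamma `^ (q - 1))%R%:E * \int[leb]_(x in Om1) (a1 x * mu1 x)%R%:E
  - (gamma `^ (q - 1))%R%:E * \int[leb]_(x in Om2) (a2 x * mu2 x)%R%:E.

Definition Pdag_minimizer (Om1 Om2 : set (Rn R n)) (c : Rn R n * Rn R n -> R)
    (gamma q : R) (mu1 mu2 : Rn R n -> R) (a1 a2 : Rn R n -> R) : Prop :=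
  Pdag_admissible Om1 Om2 c gamma q a1 a2 /\
  forall b1 b2 : Rn R n -> R, Pdag_admissible Om1 Om2 c gamma q b1 b2 ->
    Pdag_Lambda Om1 Om2 c gamma q mu1 mu2 a1 a2
    <= Pdag_Lambda Om1 Om2 c gamma q mu1 mu2 b1 b2.

End problem_P_dagger.

(* Main.v *)
Require Import Defs.
From HB Require Import structures.
From mathcomp Require Import all_boot all_order all_algebra.
From mathcomp Require Import all_classical all_reals all_analysis.
From mathcomp Require Import measurable_realfun ring lra.
Import Order.TTheory GRing.Theory Num.Theory.
Import numFieldNormedType.Exports.
Local Open Scope classical_set_scope.
Local Open Scope ring_scope.

(* The positive parts of a1 and a2 are in L^q: c is bounded above, and by Fubini
   some slice of (a1 (+) a2 - c)_+ is in L^q.  The negative parts are even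
   bounded: raising a1 to max(a1, -T), with increment h >= 0, increases the first
   term of Lambda by at most (int h)(int (a2 - T - cdag)_+^(q-1)), by convexity of
   t |-> t_+^q, and decreases the second one by at least
   gamma^(q-1) delta (int h).  Since
   (a2 - T - cdag)_+^(q-1) <= (a2_+)^q / (T + cdag),
   for large T minimality forces int h = 0, i.e. a1 >= -T a.e. *)

Set Implicit Arguments.
Unset Strict Implicit.
Unset Printing Implicit Defensive.

(** * Borel measurability of functions continuous on a subset of R^n x R^n *)

Lemma measurable_Rn_ball (R : realType) (n : nat) (x : Rn R n) (e : R) :
  measurable (ball x e : set (Rn R n)).
Proof.
have [e0|e0] := leP e 0.
  have -> : (ball x e : set (Rn R n)) = set0.
    by rewrite -subset0 => y [e_gt0 _]; move: (lt_le_trans e_gt0 e0); rewrite ltxx.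
  exact: measurable0.
(* Balls are those of the sup norm, hence boxes: finite intersections of preimages of intervals
   under the coordinates. *)
have -> : (ball x e : set (Rn R n)) =
    \bigcap_(i in [set: 'I_n]) (@Rn_coor R n i @^-1` ball (x ord0 i) e).
  apply/seteqP; split => [y [_ xy] i _|y xy]; first exact: xy.
  by split=> // i j; rewrite (ord1 i); exact: xy.
apply: fin_bigcap_measurable => // i _.
rewrite -[X in measurable X]setTI; apply: measurable_Rn_coor => //.
exact: measurable_ball.
Qed.

Lemma Rn_rat_approx (R : realType) (n : nat) (x : Rn R n) (e : R) :
  0 < e -> exists v : 'rV[rat]_n, ball (map_mx ratr v : Rn R n) e x.
Proof.
move=> e0.
have /choice[f fP] : forall i : 'I_n, exists r : rat, ratr r \in `]x ord0 i - e, x ord0 i + e[.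
  by move=> i; apply: rat_in_itvoo; lra.
exists (\row_i f i); split => // i j; rewrite !mxE (ord1 i) /ball/= /ball_/=.
by have := fP j; rewrite in_itv/= => /andP[h1 h2]; rewrite ltr_norml; apply/andP; split; lra.
Qed.

(** The product sigma-algebra is generated by coordinates, so second countability has to link it to
    the topology: an open set is the union of the products of two balls with rational centres and a
    common rational radius that it contains, and these are countably many. *)
Lemma open_Rn_prod_measurable (R : realType) (n : nat)
  (U : set (Rn R n * Rn R n)) : open U -> measurable U.
Proof.
move=> oU.
pose B (t : 'rV[rat]_n * 'rV[rat]_n * rat) : set (Rn R n * Rn R n) :=
  ball (map_mx ratr t.1.1 : Rn R n) (ratr t.2) `*`
  ball (map_mx ratr t.1.2 : Rn R n) (ratr t.2).
have -> : U = \bigcup_(t in [set: _]) (if `[< B t `<=` U >] then B t else set0).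
  apply/seteqP; split => [z Uz|z [t _]]; last by case: asboolP => // tU /tU.
  have /nbhs_ballP[e /= e0 zU] := (open_nbhs_nbhs (conj oU Uz)).
  (* With a radius below [e / 2], a rational ball containing a component of [z] lies in the ball of
     radius [e] around that component, by the triangle inequality through the centre. *)
  have /rat_in_itvoo[r] : 0 < e / 2 by lra.
  rewrite in_itv/= => /andP[r0 re].
  have [v1 v1z] := @Rn_rat_approx _ _ z.1 _ r0.
  have [v2 v2z] := @Rn_rat_approx _ _ z.2 _ r0.
  exists (v1, v2, r) => //; case: asboolP => [_|]; first by split.
  case=> -[y1 y2] [/= B1 B2]; apply: zU.
  have re2 : ratr r + ratr r <= e :> R by lra.
  split => /=; apply: (le_ball re2).
  - exact: (ball_triangle (ball_sym v1z) B1).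
  - exact: (ball_triangle (ball_sym v2z) B2).
apply: countable_bigcupT_measurable => // t; case: asboolP => // _.
by apply: measurableX; exact: measurable_Rn_ball.
Qed.

Lemma within_continuous_measurable_fun (R : realType) (n : nat)
    (D : set (Rn R n * Rn R n)) (f : Rn R n * Rn R n -> R) :
  measurable D -> {within D, continuous f} -> measurable_fun D f.
Proof.
move=> mD /continuousP cf; apply: (measurability _ (RGenOpens.measurableE R)).
move=> _ [_ [a [b ->] <-]].
have /open_subspaceP[V oV VD] : open (f @^-1` `]a, b[ : set (subspace D)).
  exact/cf/interval_open.
by rewrite setIC -VD; apply: measurableI => //; exact: open_Rn_prod_measurable.
Qed.

(** * Tonelli's theorem on a rectangle [D1 x D2], through extension by zero *)

Lemma ge0_integral_setX (d1 d2 : measure_display) (T1 : measurableType d1)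
    (T2 : measurableType d2) (R : realType)
    (m1 : {sigma_finite_measure set T1 -> \bar R})
    (m2 : {sigma_finite_measure set T2 -> \bar R}) (D1 : set T1) (D2 : set T2)
    (f : T1 * T2 -> \bar R) :
  measurable D1 -> measurable D2 -> measurable_fun (D1 `*` D2) f ->
  (forall z, (D1 `*` D2) z -> (0 <= f z)%E) ->
  (\int[m1 \x m2]_(z in D1 `*` D2) f z =
   \int[m1]_(x in D1) \int[m2]_(y in D2) f (x, y))%E.
Proof.
move=> mD1 mD2 mf f0.
rewrite integral_mkcond fubini_tonelli1/=; last 2 first.
- by apply/measurable_restrict => //; [exact: measurableX|rewrite setTI].
- exact: erestrict_ge0.
rewrite [RHS]integral_mkcond; apply: eq_integral => x _.
rewrite /fubini_F [RHS]patchE; case: ifPn => xD1.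
  rewrite [RHS]integral_mkcond; apply: eq_integral => y _.
  by rewrite !patchE in_setX/= xD1.
by apply: integral0_eq => y _; rewrite patchE in_setX/= (negbTE xD1).
Qed.

Lemma measurable_fun_setX_swap (d1 d2 d : measure_display) (T1 : measurableType d1)
    (T2 : measurableType d2) (T : measurableType d) (D1 : set T1) (D2 : set T2)
    (f : T1 * T2 -> T) :
  measurable D1 -> measurable D2 -> measurable_fun (D1 `*` D2) f ->
  measurable_fun (D2 `*` D1) (fun z => f (z.2, z.1)).
Proof.
move=> mD1 mD2 mf; pose s (z : T2 * T1) := (z.2, z.1).
apply: (@measurable_comp _ _ _ _ _ _ (D1 `*` D2) f _ s) => //.
- exact: measurableX.
- by move=> _ [[y x] [/= Dy Dx] <-].
- exact: (measurable_funTS (@measurable_swap _ _ T2 T1)).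
Qed.

Lemma ge0_integral_setX_swap (d1 d2 : measure_display) (T1 : measurableType d1)
    (T2 : measurableType d2) (R : realType)
    (m1 : {sigma_finite_measure set T1 -> \bar R})
    (m2 : {sigma_finite_measure set T2 -> \bar R}) (D1 : set T1) (D2 : set T2)
    (f : T1 * T2 -> \bar R) :
  measurable D1 -> measurable D2 -> measurable_fun (D1 `*` D2) f ->
  (forall z, (D1 `*` D2) z -> (0 <= f z)%E) ->
  (\int[m1 \x m2]_(z in D1 `*` D2) f z =
   \int[m2 \x m1]_(z in D2 `*` D1) f (z.2, z.1))%E.
Proof.
move=> mD1 mD2 mf f0.
rewrite integral_mkcond fubini_tonelli2/=; last 2 first.
- by apply/measurable_restrict => //; [exact: measurableX|rewrite setTI].
- exact: erestrict_ge0.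
rewrite [RHS]integral_mkcond fubini_tonelli1/=; last 2 first.
- apply/measurable_restrict => //; [exact: measurableX|rewrite setTI].
  exact: measurable_fun_setX_swap.
- by apply: erestrict_ge0 => -[y x] [Dy Dx]; exact: f0.
apply: eq_integral => y _; apply: eq_integral => x _.
by rewrite !patchE !in_setX/= andbC.
Qed.

Lemma ge0_integral_setXM (d1 d2 : measure_display) (T1 : measurableType d1)
    (T2 : measurableType d2) (R : realType)
    (m1 : {sigma_finite_measure set T1 -> \bar R})
    (m2 : {sigma_finite_measure set T2 -> \bar R}) (D1 : set T1) (D2 : set T2)
    (f : T1 -> R) (g : T2 -> R) :
  measurable D1 -> measurable D2 -> measurable_fun D1 f -> measurable_fun D2 g ->
  (forall x, 0 <= f x) -> (forall y, 0 <= g y) ->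
  (\int[m1 \x m2]_(z in D1 `*` D2) (f z.1 * g z.2)%:E =
   (\int[m1]_(x in D1) (f x)%:E) * \int[m2]_(y in D2) (g y)%:E)%E.
Proof.
move=> mD1 mD2 mf mg f0 g0.
have g0' y : D2 y -> (0 <= (g y)%:E)%E by rewrite lee_fin.
have mg' : measurable_fun D2 (EFin \o g) by exact/measurable_EFinP.
rewrite ge0_integral_setX//; last 2 first.
- apply/measurable_EFinP; apply: measurable_funM.
  + apply: (@measurable_comp _ _ _ _ _ _ D1 f) => //.
      by move=> _ [z [Dz _] <-].
    exact: (measurable_funTS measurable_fst).
  + apply: (@measurable_comp _ _ _ _ _ _ D2 g) => //.
      by move=> _ [z [_ Dz] <-].
    exact: (measurable_funTS measurable_snd).
- by move=> z _; rewrite lee_fin mulr_ge0.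
transitivity (\int[m1]_(x in D1) ((f x)%:E * \int[m2]_(y in D2) (g y)%:E))%E.
  by apply: eq_integral => x _ /=; rewrite -ge0_integralZl_EFin.
rewrite ge0_integralZr//.
- exact/measurable_EFinP.
- by move=> x _; rewrite lee_fin.
- exact: integral_ge0.
Qed.

(** * Convexity inequalities for t^q and (t_+)^q *)

Lemma powR_convex_le (R : realType) (q x y : R) : 1 < q -> 0 <= x -> 0 <= y ->
  y `^ q <= x `^ q + q * (y - x) * y `^ (q - 1).
Proof.
move=> q1 x0 y0.
have [->|yneq0] := eqVneq y 0.
  by rewrite !powR0 ?mulr0 ?addr0 ?powR_ge0//; lra.
have yp : 0 < y by rewrite lt_neqAle eq_sym yneq0.
have pe : q^-1 + (q / (q - 1))^-1 = 1 by field; lra.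
have p0 : 0 < q / (q - 1) by rewrite divr_gt0; lra.
have q0 : 0 < q by lra.
(* Young's inequality for [x] and y^(q-1), with exponents [q] and q/(q-1). As y^(q-1) raised to
   q/(q-1) is y^q, multiplying by [q] gives the tangent inequality at [y]. *)
have := conjugate_powR x0 (powR_ge0 y (q - 1)) q0 p0 pe.
rewrite -powRrM.
have -> : (q - 1) * (q / (q - 1)) = q by field; lra.
have -> : y `^ q = y * y `^ (q - 1).
  by rewrite -{2}(powRr1 y0) -powRD ?yneq0 ?implybT//; congr (_ `^ _); lra.
set Y := y `^ (q - 1) => h.
have : q * (x * Y) <= q * (x `^ q / q + y * Y / (q / (q - 1))) by rewrite ler_pM2l.
have -> : q * (x `^ q / q + y * Y / (q / (q - 1))) = x `^ q + y * Y * (q - 1) by field; lra.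
lra.
Qed.

(** For [v > 0] this is the tangent inequality at [v] compared with u_+, weakened by u_+ >= u. For
    [v <= 0] the left side is 0 and the right side is nonnegative because [u <= v]. *)
Lemma max0_powR_convex_le (R : realType) (q u v : R) : 1 < q -> u <= v ->
  Num.max v 0 `^ q <= Num.max u 0 `^ q + q * (v - u) * Num.max v 0 `^ (q - 1).
Proof.
move=> q1 uv.
have [v0|v0] := leP v 0.
  by rewrite powR0 ?addr_ge0 ?powR_ge0 ?mulr_ge0 ?powR_ge0//; lra.
have x0 : 0 <= Num.max u 0 by rewrite le_max lexx orbT.
apply: (le_trans (powR_convex_le q1 x0 (ltW v0))).
rewrite lerD2l ler_wpM2r ?powR_ge0// ler_wpM2l; first by []; first lra.
by rewrite lerB// le_max lexx.
Qed.

(** * Integrability criteria: domination, densities bounded below, pairing of L^p with L^q *)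

Lemma measurable_EFin_powR (d : measure_display) (T : measurableType d)
    (R : realType) (D : set T) (f : T -> R) (q : R) :
  measurable_fun D f -> measurable_fun D (fun x => (f x `^ q)%:E).
Proof.
by move=> mf; apply/measurable_EFinP; exact: (measurableT_comp (measurable_powR q)).
Qed.

Lemma ae_ge0_integral_lty_dominated (d : measure_display) (T : measurableType d)
    (R : realType) (mu : {measure set T -> \bar R}) (D : set T) (f g : T -> R)
    (k B : R) :
  measurable D -> (mu D < +oo)%E -> measurable_fun D f -> measurable_fun D g ->
  0 <= k -> 0 <= B -> (forall x, D x -> 0 <= f x) -> (forall x, D x -> 0 <= g x) ->
  {ae mu, forall x, D x -> f x <= k * g x + B} ->
  (\int[mu]_(x in D) (g x)%:E < +oo)%E -> (\int[mu]_(x in D) (f x)%:E < +oo)%E.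
Proof.
move=> mD Doo mf mg k0 B0 f0 g0 fg goo.
have mg' : measurable_fun D (fun x => (g x)%:E) by exact/measurable_EFinP.
have mkg : measurable_fun D (fun x => k%:E * (g x)%:E)%E.
  by apply/measurable_EFinP/measurable_funM.
have g0' x : D x -> (0 <= (g x)%:E)%E by move=> /g0; rewrite lee_fin.
have kg0 x : D x -> (0 <= k%:E * (g x)%:E)%E by move=> /g0'; exact: mule_ge0.
apply: (@le_lt_trans _ _ (\int[mu]_(x in D) (k%:E * (g x)%:E + cst B%:E x))%E).
  apply: ae_ge0_le_integral => //.
  - exact/measurable_EFinP.
  - by move=> x Dx; rewrite adde_ge0 ?kg0.
  - exact: emeasurable_funD.
rewrite ge0_integralD// integral_cst// ge0_integralZl_EFin//.
by rewrite lte_add_pinfty// lte_mul_pinfty.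
Qed.

Lemma ge0_integral_lty_dominated (d : measure_display) (T : measurableType d)
    (R : realType) (mu : {measure set T -> \bar R}) (D : set T) (f g : T -> R)
    (k B : R) :
  measurable D -> (mu D < +oo)%E -> measurable_fun D f -> measurable_fun D g ->
  0 <= k -> 0 <= B -> (forall x, D x -> 0 <= f x) -> (forall x, D x -> 0 <= g x) ->
  (forall x, D x -> f x <= k * g x + B) ->
  (\int[mu]_(x in D) (g x)%:E < +oo)%E -> (\int[mu]_(x in D) (f x)%:E < +oo)%E.
Proof.
move=> mD Doo mf mg k0 B0 f0 g0 fg.
by apply: (ae_ge0_integral_lty_dominated mD Doo mf mg k0 B0 f0 g0); apply: aeW.
Qed.

(** Markov's inequality: [delta] times the measure of [D] is at most the integral of |f|, which is
    finite because the integral of [f] is. *)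
Lemma ae_lower_bound_measure_lty (d : measure_display) (T : measurableType d)
    (R : realType) (mu : {measure set T -> \bar R}) (D : set T) (f : T -> R)
    (delta : R) :
  measurable D -> measurable_fun D f -> 0 < delta ->
  {ae mu, forall x, D x -> delta <= f x} ->
  (\int[mu]_(x in D) (f x)%:E = 1)%E -> (mu D < +oo)%E.
Proof.
move=> mD mf d0 fd f1.
have : (\int[mu]_(x in D) (cst delta%:E x) <= \int[mu]_(x in D) `|(f x)%:E|)%E.
  apply: ae_ge0_le_integral => //.
  - by move=> x _; rewrite lee_fin ltW.
  - by apply: measurableT_comp => //; exact/measurable_EFinP.
  - apply: filterS fd => x /[apply] dx; rewrite lee_fin.
    by rewrite (le_trans dx)// ler_norm.
rewrite integral_cst// => le1.
have : (\int[mu]_(x in D) `|(f x)%:E| < +oo)%E.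
  by rewrite integral_fin_num_abs// f1.
move=> /(le_lt_trans le1).
by rewrite !ltey; apply: contra_neq => ->; rewrite gt0_muley ?lte_fin.
Qed.

Lemma inLp_divrP (d : measure_display) (T : measurableType d)
    (R : realType) (mu : {measure set T -> \bar R}) (D : set T) (f : T -> R)
    (gamma q : R) :
  measurable D -> measurable_fun D f -> (forall x, 0 <= f x) -> 0 < gamma ->
  inLp mu D q (fun x => f x / gamma) <->
  (\int[mu]_(x in D) (f x `^ q)%:E < +oo)%E.
Proof.
move=> mD mf f0 g0.
have E : (\int[mu]_(x in D) (`|f x / gamma| `^ q)%:E =
    (gamma^-1 `^ q)%:E * \int[mu]_(x in D) (f x `^ q)%:E)%E.
  rewrite -ge0_integralZl_EFin ?powR_ge0//.
  - have gi0 : 0 <= gamma^-1 by rewrite invr_ge0 ltW.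
    apply: eq_integral => x _; rewrite -EFinM; congr EFin.
    by rewrite -powRM// mulrC ger0_norm// mulr_ge0.
  - by move=> x _; rewrite lee_fin powR_ge0.
  - exact: measurable_EFin_powR.
have k0 : 0 < gamma^-1 `^ q by rewrite powR_gt0// invr_gt0.
rewrite /inLp E; split=> [[_]|foo].
  by rewrite !ltey; apply: contra_neq => ->; rewrite gt0_muley ?lte_fin.
split; first exact: measurable_funM.
by rewrite lte_mul_pinfty ?lee_fin ?ltW.
Qed.

(** Young's inequality bounds the positive part of [f * g], which is f_+ g a.e., by g^p/p +
    (f_+)^q/q. Nothing controls the negative part here, so the integral may still be -oo. *)
Lemma integral_mulr_ltey (d : measure_display) (T : measurableType d)
    (R : realType) (mu : {measure set T -> \bar R}) (D : set T) (f g : T -> R)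
    (p q : R) :
  measurable D -> (mu D < +oo)%E -> 0 < p -> 0 < q -> p^-1 + q^-1 = 1 ->
  measurable_fun D f -> (\int[mu]_(x in D) (Num.max (f x) 0 `^ q)%:E < +oo)%E ->
  inLp mu D p g -> {ae mu, forall x, D x -> 0 <= g x} ->
  (\int[mu]_(x in D) (f x * g x)%:E < +oo)%E.
Proof.
move=> mD Doo p0 q0 pq mf foo [mg goo] g0.
have m0 x : 0 <= Num.max (f x) 0 by rewrite le_max lexx orbT.
have mfg : measurable_fun D (fun x => f x * g x) by exact: measurable_funM.
have mmax : measurable_fun D (fun x => Num.max (f x) 0) by exact: measurable_maxr.
have mgp : measurable_fun D (fun x => `|g x| `^ p).
  by apply: (measurableT_comp (measurable_powR p)); exact: measurableT_comp.
have mfq : measurable_fun D (fun x => Num.max (f x) 0 `^ q).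
  exact: (measurableT_comp (measurable_powR q)).
have mgpp : measurable_fun D (fun x => `|g x| `^ p / p) by exact: measurable_funM.
have mfqq : measurable_fun D (fun x => Num.max (f x) 0 `^ q / q).
  exact: measurable_funM.
have gp0 x : D x -> 0 <= `|g x| `^ p / p by rewrite divr_ge0 ?powR_ge0 ?ltW.
have fq0 x : D x -> 0 <= Num.max (f x) 0 `^ q / q by rewrite divr_ge0 ?powR_ge0 ?ltW.
have Poo : (\int[mu]_(x in D) (`|g x| `^ p / p + Num.max (f x) 0 `^ q / q)%:E < +oo)%E.
  under eq_integral do rewrite EFinD.
  rewrite ge0_integralD//; last 2 first.
    exact/measurable_EFinP.
    exact/measurable_EFinP.
  rewrite lte_add_pinfty//.
  - have gpp x : D x -> `|g x| `^ p / p <= p^-1 * `|g x| `^ p + 0.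
      by rewrite addr0 mulrC.
    have pV : 0 <= p^-1 by rewrite invr_ge0 ltW.
    exact: (ge0_integral_lty_dominated mD Doo mgpp mgp pV (lexx 0) gp0
      (fun x _ => powR_ge0 _ _) gpp).
  - have fqq x : D x -> Num.max (f x) 0 `^ q / q <= q^-1 * Num.max (f x) 0 `^ q + 0.
      by rewrite addr0 mulrC.
    have qV : 0 <= q^-1 by rewrite invr_ge0 ltW.
    exact: (ge0_integral_lty_dominated mD Doo mfqq mfq qV (lexx 0) fq0
      (fun x _ => powR_ge0 _ _) fqq).
have pos : (\int[mu]_(x in D) (Num.max (f x * g x) 0)%:E < +oo)%E.
  have young : {ae mu, forall x, D x ->
      Num.max (f x * g x) 0 <= 1 * (`|g x| `^ p / p + Num.max (f x) 0 `^ q / q) + 0}.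
    apply: filterS g0 => x /[apply] gx; rewrite mul1r addr0.
    apply: (le_trans _ (conjugate_powR (normr_ge0 (g x)) (m0 x) p0 q0 pq)).
    by rewrite ge_max mulr_ge0// andbT ger0_norm// mulrC ler_wpM2l// le_max lexx.
  have mfg0 : measurable_fun D (fun x => Num.max (f x * g x) 0).
    exact: measurable_maxr.
  apply: (ae_ge0_integral_lty_dominated mD Doo mfg0 _ ler01 (lexx 0) _ _ young Poo).
  - exact: measurable_funD.
  - by move=> x _; rewrite le_max lexx orbT.
  - by move=> x Dx; rewrite addr_ge0 ?gp0 ?fq0.
rewrite integralE.
apply: (@le_lt_trans _ _ (\int[mu]_(x in D) (Num.max (f x * g x) 0)%:E)%E) => //.
have -> : (\int[mu]_(x in D) (Num.max (f x * g x) 0)%:E =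
   \int[mu]_(x in D) (fun x => (f x * g x)%:E)^\+ x)%E.
  by apply: eq_integral => x _; rewrite funeposE EFin_max.
by rewrite geeDl// oppe_le0; apply: integral_ge0 => x _; exact: funeneg_ge0.
Qed.

(** * Integrability of the positive parts, from one slice *)

Section problem_P_dagger_minimizers.
Context (R : realType) (n : nat).
Local Notation leb := (@lebesgue_Rn R n).

Lemma oplus_pos_ge0 (c : Rn R n * Rn R n -> R) (a1 a2 : Rn R n -> R) z :
  0 <= oplus_pos c a1 a2 z.
Proof. by rewrite /oplus_pos le_max lexx orbT. Qed.

Lemma measurable_oplus_pos (Om1 Om2 : set (Rn R n)) (c : Rn R n * Rn R n -> R)
    (a1 a2 : Rn R n -> R) :
  measurable Om1 -> measurable Om2 -> measurable_fun (Om1 `*` Om2) c ->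
  measurable_fun Om1 a1 -> measurable_fun Om2 a2 ->
  measurable_fun (Om1 `*` Om2) (oplus_pos c a1 a2).
Proof.
move=> mOm1 mOm2 mc ma1 ma2; apply: measurable_maxr => //.
apply: measurable_funB => //; apply: measurable_funD.
- apply: (@measurable_comp _ _ _ _ _ _ Om1 a1) => //.
    by move=> _ [z [Dz _] <-].
  exact: (measurable_funTS measurable_fst).
- apply: (@measurable_comp _ _ _ _ _ _ Om2 a2) => //.
    by move=> _ [z [_ Dz] <-].
  exact: (measurable_funTS measurable_snd).
Qed.

Lemma oplus_pos_slice_pos_part (Om1 Om2 : set (Rn R n))
    (c : Rn R n * Rn R n -> R) (C q : R) (a1 a2 : Rn R n -> R) :
  measurable Om1 -> measurable Om2 -> measurable_fun (Om1 `*` Om2) c ->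
  measurable_fun Om1 a1 -> measurable_fun Om2 a2 ->
  (0 < leb Om1)%E -> (leb Om2 < +oo)%E -> 0 <= q ->
  (forall z, (Om1 `*` Om2) z -> c z <= C) ->
  (\int[leb \x leb]_(z in Om1 `*` Om2) (oplus_pos c a1 a2 z `^ q)%:E < +oo)%E ->
  (\int[leb]_(y in Om2) (Num.max (a2 y) 0 `^ q)%:E < +oo)%E.
Proof.
move=> mOm1 mOm2 mc ma1 ma2 Om1_gt0 Om2oo q0 cC.
have mopl := measurable_oplus_pos mOm1 mOm2 mc ma1 ma2.
rewrite ge0_integral_setX//; last 2 first.
- exact: measurable_EFin_powR.
- by move=> z _; rewrite lee_fin powR_ge0.
move=> Xoo.
(* If all slice integrals were infinite, Tonelli would give +oo times the positive measure of [Om1],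
   which is +oo. *)
have [x Om1x slice_oo] : exists2 x, Om1 x &
    (\int[leb]_(y in Om2) (oplus_pos c a1 a2 (x, y) `^ q)%:E < +oo)%E.
  apply: contrapT => noslice; move: Xoo.
  rewrite (eq_integral (cst +oo%E)); last first.
    move=> x /[!inE] Om1x; apply/eqP; rewrite -leye_eq leNgt.
    by apply/negP => slice_oo; apply: noslice; exists x.
  by rewrite integral_cst// gt0_mulye// ltxx.
pose s y := oplus_pos c a1 a2 (x, y).
have ms : measurable_fun Om2 s.
  apply: (@measurable_comp _ _ _ _ _ _ (Om1 `*` Om2) (oplus_pos c a1 a2) _ (pair x)) => //.
  - exact: measurableX.
  - by move=> _ [y Om2y <-].
  - exact: (measurable_funTS (pair1_measurable x)).
(* Since c <= C, a2 y <= s y + (C - a1 x) along the slice; the maximum with 0 makes (a2 y)_+ <= s y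
   + K. *)
pose K := Num.max (C - a1 x) 0.
have K0 : 0 <= K by rewrite le_max lexx orbT.
have dom y : Om2 y ->
    Num.max (a2 y) 0 `^ q <= 2 `^ q * s y `^ q + 2 `^ q * K `^ q.
  move=> Om2y; rewrite -!powRM ?oplus_pos_ge0//.
  have s0 : 0 <= s y := oplus_pos_ge0 _ _ _ _.
  have sE : a1 x + a2 y - c (x, y) <= s y by rewrite /s /oplus_pos le_max lexx.
  have KE : C - a1 x <= K by rewrite le_max lexx.
  have cxy : c (x, y) <= C by apply: cC.
  have m0 : 0 <= Num.max (a2 y) 0 by rewrite le_max lexx orbT.
  have mle : Num.max (a2 y) 0 <= s y + K.
    by rewrite ge_max; apply/andP; split; lra.
  (* The sum [s y + K] is at most twice the larger summand, so its q-th power is at most one of the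
     two terms on the right. *)
  have [sK|Ks] := leP (s y) K.
  - apply: (@le_trans _ _ ((2 * K) `^ q)); last by rewrite lerDr powR_ge0.
    by apply: ge0_ler_powR; rewrite ?nnegrE//; lra.
  - apply: (@le_trans _ _ ((2 * s y) `^ q)); last by rewrite lerDl powR_ge0.
    by apply: ge0_ler_powR; rewrite ?nnegrE//; lra.
have mmax : measurable_fun Om2 (fun y => Num.max (a2 y) 0 `^ q).
  by apply: (measurableT_comp (measurable_powR q)); exact: measurable_maxr.
apply: (ge0_integral_lty_dominated mOm2 Om2oo mmax
  (measurableT_comp (measurable_powR q) ms) (powR_ge0 _ _)
  (mulr_ge0 (powR_ge0 _ _) (powR_ge0 _ _)) _ _ dom slice_oo) => y _; exact: powR_ge0.
Qed.

(** * Symmetry of the problem under exchanging the two factors *)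

Lemma Pdag_admissible_swap (Om1 Om2 : set (Rn R n)) (c : Rn R n * Rn R n -> R)
    (gamma q : R) (a1 a2 : Rn R n -> R) :
  measurable Om1 -> measurable Om2 ->
  Pdag_admissible Om1 Om2 c gamma q a1 a2 ->
  Pdag_admissible Om2 Om1 (fun z => c (z.2, z.1)) gamma q a2 a1.
Proof.
move=> mOm1 mOm2 [ha1 ha2 [mo oo]]; split; [exact: ha2|exact: ha1|].
have E : (fun z => oplus_pos (fun z => c (z.2, z.1)) a2 a1 z / gamma) =
  (fun z => (fun z => oplus_pos c a1 a2 z / gamma) (z.2, z.1)).
  by apply/funext => z; rewrite /oplus_pos/= (addrC (a1 _)).
rewrite E; split; first exact: (measurable_fun_setX_swap mOm1 mOm2 mo).
move: oo; rewrite ge0_integral_setX_swap//.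
by apply: measurable_EFin_powR; exact: measurableT_comp.
Qed.

Lemma Pdag_Lambda_swap (Om1 Om2 : set (Rn R n)) (c : Rn R n * Rn R n -> R)
    (gamma q : R) (mu1 mu2 a1 a2 : Rn R n -> R) :
  measurable Om1 -> measurable Om2 -> measurable_fun (Om1 `*` Om2) c ->
  measurable_fun Om1 a1 -> measurable_fun Om2 a2 ->
  Pdag_Lambda Om2 Om1 (fun z => c (z.2, z.1)) gamma q mu2 mu1 a2 a1 =
  Pdag_Lambda Om1 Om2 c gamma q mu1 mu2 a1 a2.
Proof.
move=> mOm1 mOm2 mc ma1 ma2.
have mX : measurable_fun (Om1 `*` Om2) (fun z => (oplus_pos c a1 a2 z `^ q)%:E).
  by apply: measurable_EFin_powR; exact: measurable_oplus_pos.
have X0 z : (Om1 `*` Om2) z -> (0 <= (oplus_pos c a1 a2 z `^ q)%:E)%E.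
  by move=> _; rewrite lee_fin powR_ge0.
have XE : (\int[leb \x leb]_(z in Om2 `*` Om1)
      (oplus_pos (fun z => c (z.2, z.1)) a2 a1 z `^ q)%:E =
    \int[leb \x leb]_(z in Om1 `*` Om2) (oplus_pos c a1 a2 z `^ q)%:E)%E.
  rewrite [RHS](ge0_integral_setX_swap leb leb mOm1 mOm2 mX X0).
  by apply: eq_integral => z _; rewrite /oplus_pos/= (addrC (a1 _)).
by rewrite /Pdag_Lambda XE addeAC.
Qed.

(** This lets results about the first potential be transferred to the second: competitors of the
    transposed problem are transposed back, where minimality is known. *)
Lemma Pdag_minimizer_swap (Om1 Om2 : set (Rn R n)) (c : Rn R n * Rn R n -> R)
    (gamma q : R) (mu1 mu2 a1 a2 : Rn R n -> R) :
  measurable Om1 -> measurable Om2 -> measurable_fun (Om1 `*` Om2) c ->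
  Pdag_minimizer Om1 Om2 c gamma q mu1 mu2 a1 a2 ->
  Pdag_minimizer Om2 Om1 (fun z => c (z.2, z.1)) gamma q mu2 mu1 a2 a1.
Proof.
move=> mOm1 mOm2 mc [adm min]; split; first exact: Pdag_admissible_swap.
move=> b2 b1 admb.
have cE : (fun z : Rn R n * Rn R n => c (z.1, z.2)) = c by apply/funext => -[].
have admb' : Pdag_admissible Om1 Om2 c gamma q b1 b2.
  by rewrite -cE; exact: (Pdag_admissible_swap mOm2 mOm1 admb).
case: (adm) => -[ma1 _] [ma2 _] _; case: (admb') => -[mb1 _] [mb2 _] _.
rewrite (Pdag_Lambda_swap _ _ _ _ mOm1 mOm2 mc ma1 ma2).
by rewrite (Pdag_Lambda_swap _ _ _ _ mOm1 mOm2 mc mb1 mb2); exact: min.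
Qed.

(** * Finiteness of the linear terms at a minimizer *)

Lemma Pdag_terms_fin_num (x g : R) (I1 I2 : \bar R) : 0 < g ->
  (I1 < +oo)%E -> (I2 < +oo)%E ->
  (x%:E - g%:E * I1 - g%:E * I2 < +oo)%E -> I1 \is a fin_num /\ I2 \is a fin_num.
Proof.
move=> g0; have gNy : (g%:E * -oo = -oo :> \bar R)%E by rewrite gt0_muleNy ?lte_fin.
by case: I1 => [r1| |] //; case: I2 => [r2| |] // _ _; rewrite ?gNy.
Qed.

(** A product of an L^1 and an L^p function need not be integrable, so a linear integral could be
    -oo and make Lambda equal to +oo. Comparison with a competitor of finite energy rules this
    out. *)
Lemma Pdag_minimizer_integrals_fin_num (Om1 Om2 : set (Rn R n))
    (c : Rn R n * Rn R n -> R) (cdag gamma q : R) (mu1 mu2 a1 a2 : Rn R n -> R) :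
  measurable Om1 -> measurable Om2 -> measurable_fun (Om1 `*` Om2) c ->
  (forall z, (Om1 `*` Om2) z -> cdag <= c z) -> 0 < gamma -> 0 < q ->
  (leb Om2 < +oo)%E -> measurable_fun Om2 mu2 ->
  (\int[leb]_(x in Om2) (mu2 x)%:E = 1)%E ->
  (\int[leb]_(x in Om1) (a1 x * mu1 x)%:E < +oo)%E ->
  (\int[leb]_(x in Om2) (a2 x * mu2 x)%:E < +oo)%E ->
  Pdag_minimizer Om1 Om2 c gamma q mu1 mu2 a1 a2 ->
  (\int[leb]_(x in Om1) (a1 x * mu1 x)%:E)%E \is a fin_num /\
  (\int[leb]_(x in Om2) (a2 x * mu2 x)%:E)%E \is a fin_num.
Proof.
move=> mOm1 mOm2 mc hcdag g0 q0 Om2oo mmu2 mu2i I1oo I2oo [[[ma1 _] [ma2 _] opL] min].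
have mopl := measurable_oplus_pos mOm1 mOm2 mc ma1 ma2.
have mOm : measurable (Om1 `*` Om2) by exact: measurableX.
have Xoo := (inLp_divrP _ q mOm mopl (oplus_pos_ge0 c a1 a2) g0).1 opL.
have mb1 : measurable_fun Om1 (fun=> 0 : R) by exact: measurable_cst.
have mb2 : measurable_fun Om2 (fun=> cdag) by exact: measurable_cst.
have mopb := measurable_oplus_pos mOm1 mOm2 mc mb1 mb2.
have X0 : (\int[leb \x leb]_(z in Om1 `*` Om2)
    (oplus_pos c (fun=> 0) (fun=> cdag) z `^ q)%:E = 0)%E.
  apply: integral0_eq => z Omz.
  rewrite /oplus_pos max_r ?powR0 ?gt_eqF//.
  by have := hcdag _ Omz; lra.
(* The competitor is the constant pair (0, cdag): as [cdag <= c], its first term vanishes, and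
   Lambda is the finite number -gamma^(q-1) cdag. *)
have admb : Pdag_admissible Om1 Om2 c gamma q (fun=> 0) (fun=> cdag).
  split.
  - split; first exact: mb1.
    rewrite integral0_eq// => z _.
    by rewrite normr0 powR0 ?oner_eq0.
  - split; first exact: mb2.
    rewrite (integral_cst leb mOm2 (`|cdag| `^ 1)%:E).
    by rewrite lte_mul_pinfty// lee_fin powR_ge0.
  - apply: (inLp_divrP _ q mOm mopb (oplus_pos_ge0 _ _ _) g0).2.
    by rewrite X0.
have := min _ _ admb; rewrite /Pdag_Lambda X0.
have -> : (\int[leb]_(x in Om1) (0 * mu1 x)%:E = 0)%E.
  by apply: integral0_eq => z _; rewrite mul0r.
have -> : (\int[leb]_(x in Om2) (cdag * mu2 x)%:E = cdag%:E)%E.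
  have imu2 : leb.-integrable Om2 (EFin \o mu2).
    apply/integrableP; split; first exact/measurable_EFinP.
    by rewrite integral_fin_num_abs// mu2i.
  by rewrite -[RHS]mule1 -mu2i -(integralZl mOm2 imu2).
rewrite !mule0 -EFinM.
set X := (\int[leb \x leb]_(z in _) _)%E in Xoo *.
set I1 := integral _ _ _ in I1oo *.
set I2 := integral _ _ _ in I2oo *.
move=> le.
have X_ge0 : (0 <= X)%E.
  by apply: integral_ge0 => z _; rewrite lee_fin powR_ge0.
have Xfin : X \is a fin_num by rewrite ge0_fin_numE.
move: X I1 I2 {X_ge0} Xfin Xoo I1oo I2oo le => X I1 I2 Xfin _ I1oo I2oo le.
apply: (@Pdag_terms_fin_num (q^-1 * fine X) (gamma `^ (q - 1))) => //.
  exact: powR_gt0.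
rewrite EFinM fineK//; apply: (le_lt_trans le).
by rewrite sube0 add0e -EFinN ltry.
Qed.

(** * Truncation from below and boundedness of the negative part *)

Lemma oplus_pos_truncation_le (c : Rn R n * Rn R n -> R) (cdag q T : R)
    (a1 a2 : Rn R n -> R) (z : Rn R n * Rn R n) :
  1 < q -> 0 < T + cdag -> cdag <= c z ->
  oplus_pos c (fun x => Num.max (a1 x) (- T)) a2 z `^ q <=
  oplus_pos c a1 a2 z `^ q + q * ((Num.max (a1 z.1) (- T) - a1 z.1) *
    (Num.max (a2 z.2) 0 `^ q / (T + cdag))).
Proof.
move=> q1 t0 cz; rewrite /oplus_pos.
set b := Num.max (a1 z.1) (- T); set W := _ / (T + cdag).
have ab : a1 z.1 <= b by rewrite le_max lexx.
have uv : a1 z.1 + a2 z.2 - c z <= b + a2 z.2 - c z by lra.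
apply: (le_trans (max0_powR_convex_le q1 uv)).
have -> : b + a2 z.2 - c z - (a1 z.1 + a2 z.2 - c z) = b - a1 z.1 by ring.
rewrite lerD2l -mulrA; apply: ler_wpM2l; first by lra.
have W0 : 0 <= W by rewrite divr_ge0 ?powR_ge0 ?ltW.
(* Where a1 >= -T the increment is zero; elsewhere the truncated value is -T, and only v^(q-1) <= W
   remains to be shown for v = (-T + a2 - c)_+. *)
rewrite /b; have [Ta|aT] := leP (- T) (a1 z.1); first by rewrite subrr !mul0r.
apply: ler_wpM2l; first by lra.
have [v0|v0] := leP (- T + a2 z.2 - c z) 0; first by rewrite powR0//; lra.
(* Positivity of -T + a2 - c, with [cdag <= c], forces a2 > T + cdag. Hence v^(q-1) (T + cdag) <=
   a2^(q-1) a2 = a2^q. *)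
have a2t : T + cdag < a2 z.2 by lra.
have a20 : 0 < a2 z.2 by lra.
rewrite /W (max_l (ltW a20)) ler_pdivlMr//.
apply: (@le_trans _ _ (a2 z.2 `^ (q - 1) * a2 z.2)).
  apply: ler_pM; [exact: powR_ge0|lra| |lra].
  by apply: ge0_ler_powR; rewrite ?nnegrE; lra.
rewrite -{2}(powRr1 (ltW a20)) -powRD ?(gt_eqF a20) ?implybT//.
by rewrite subrK.
Qed.

(** Once everything is finite, minimality reads g k <= (xb - x)/q <= h w, while g delta h <= g k;
    with w < g delta this forces h = 0. Here [x], [xb] are the integrals of the q-th powers before
    and after truncation, [k] is the increase of the first linear integral and [h] the mass of the
    increment. *)
Lemma increment_eq0 (q g delta w : R) (x xb i1 i2 k h : \bar R) :
  0 < q -> 0 < g -> w < g * delta ->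
  x \is a fin_num -> xb \is a fin_num -> i1 \is a fin_num -> i2 \is a fin_num ->
  k \is a fin_num -> h \is a fin_num -> (0 <= h)%E ->
  (xb <= x + q%:E * (h * w%:E))%E -> (delta%:E * h <= k)%E ->
  (q^-1%:E * x - g%:E * i1 - g%:E * i2 <=
   q^-1%:E * xb - g%:E * (i1 + k) - g%:E * i2)%E -> h = 0%E.
Proof.
case: x => [x| |] //; case: xb => [xb| |] //; case: i1 => [i1| |] //.
case: i2 => [i2| |] //; case: k => [k| |] //; case: h => [h| |] //.
move=> q0 g0 wg _ _ _ _ _ _; rewrite -!(EFinM, EFinN, EFinD) !lee_fin.
move=> h0 xble hk le; congr EFin.
have qxb : q^-1 * xb <= q^-1 * x + h * w.
  have -> : q^-1 * x + h * w = q^-1 * (x + q * (h * w)) by field; lra.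
  by rewrite ler_pM2l ?invr_gt0.
have gk : g * (delta * h) <= g * k by rewrite ler_pM2l.
move: h0; rewrite le_eqVlt => /predU1P[//|h_gt0].
have : w * h < g * delta * h by rewrite ltr_pM2r.
lra.
Qed.

Lemma Pdag_minimizer_ae_bounded_below (Om1 Om2 : set (Rn R n))
    (c : Rn R n * Rn R n -> R) (cdag gamma q delta : R)
    (mu1 mu2 a1 a2 : Rn R n -> R) :
  measurable Om1 -> measurable Om2 -> measurable_fun (Om1 `*` Om2) c ->
  (forall z, (Om1 `*` Om2) z -> cdag <= c z) -> 0 < gamma -> 1 < q -> 0 < delta ->
  measurable_fun Om1 mu1 ->
  {ae leb, forall x, Om1 x -> delta <= mu1 x} ->
  (\int[leb]_(x in Om1) (a1 x * mu1 x)%:E)%E \is a fin_num ->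
  (\int[leb]_(x in Om2) (a2 x * mu2 x)%:E)%E \is a fin_num ->
  (\int[leb]_(y in Om2) (Num.max (a2 y) 0 `^ q)%:E < +oo)%E ->
  Pdag_minimizer Om1 Om2 c gamma q mu1 mu2 a1 a2 ->
  exists2 T, 0 <= T & {ae leb, forall x, Om1 x -> - T <= a1 x}.
Proof.
move=> mOm1 mOm2 mc hcdag gam0 q1 d0 mmu1 mu1d I1fin I2fin Coo.
move=> [[[ma1 a1L1] [ma2 a2L1] opL] min].
have q0 : 0 < q by lra.
have mopl := measurable_oplus_pos mOm1 mOm2 mc ma1 ma2.
have mOm : measurable (Om1 `*` Om2) by exact: measurableX.
have Xoo := (inLp_divrP _ q mOm mopl (oplus_pos_ge0 c a1 a2) gam0).1 opL.
have g0 : 0 < gamma `^ (q - 1) by exact: powR_gt0.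
have C_ge0 : (0 <= \int[leb]_(y in Om2) (Num.max (a2 y) 0 `^ q)%:E)%E.
  by apply: integral_ge0 => y _; rewrite lee_fin powR_ge0.
have Cfin : (\int[leb]_(y in Om2) (Num.max (a2 y) 0 `^ q)%:E)%E \is a fin_num.
  by rewrite (ge0_fin_numE C_ge0); exact: Coo.
pose C := fine (\int[leb]_(y in Om2) (Num.max (a2 y) 0 `^ q)%:E)%E.
have C0 : 0 <= C by exact: fine_ge0.
pose g := gamma `^ (q - 1).
have gd0 : 0 < g * delta by exact: mulr_gt0.
(* The level is chosen so that T + cdag >= S > C / (g delta), i.e. C / (T + cdag) < g delta. The
   term |cdag| in [T] absorbs the sign of [cdag], and the 1 keeps [S] positive. *)
pose S := C / (g * delta) + 1.
have CS : 0 <= C / (g * delta) by rewrite divr_ge0// ltW.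
pose T := `|cdag| + S.
have Tc : S <= T + cdag.
  by rewrite /T; have := ler_norm (- cdag); rewrite normrN; lra.
have t0 : 0 < T + cdag by rewrite (lt_le_trans _ Tc)// /S; lra.
have T0 : 0 <= T by rewrite addr_ge0// /S; lra.
have wlt : C / (T + cdag) < g * delta.
  rewrite ltr_pdivrMr//; apply: (@lt_le_trans _ _ (g * delta * S)); last first.
    by rewrite ler_pM2l.
  by rewrite /S mulrDr mulr1 mulrC divfK ?gt_eqF// ltrDl.
exists T => //.
pose b1 x := Num.max (a1 x) (- T); pose h x := b1 x - a1 x.
pose W y := Num.max (a2 y) 0 `^ q / (T + cdag).
have mb1 : measurable_fun Om1 b1 by exact: measurable_maxr.
have mh : measurable_fun Om1 h by exact: measurable_funB.
have mW0 : measurable_fun Om2 (fun y => Num.max (a2 y) 0 `^ q).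
  by apply: (measurableT_comp (measurable_powR q)); exact: measurable_maxr.
have mW : measurable_fun Om2 W by exact: measurable_funM.
have h0 x : 0 <= h x by rewrite subr_ge0 le_max lexx.
have W0 y : 0 <= W y by rewrite divr_ge0 ?powR_ge0 ?ltW.
(* As -T <= 0, truncation only moves values towards zero, so both the increment and [b1] are
   dominated by |a1| and inherit integrability. *)
have ha x : h x <= `|a1 x|.
  rewrite /h /b1; have [_|aT] := leP (- T) (a1 x); first by rewrite subrr.
  have a0 : a1 x < 0 by rewrite (lt_le_trans aT)// oppr_le0.
  by rewrite (ltr0_norm a0) addrC gerDl oppr_le0.
have ba x : `|b1 x| <= `|a1 x|.
  rewrite /b1; have [//|aT] := leP (- T) (a1 x).
  have a0 : a1 x < 0 by rewrite (lt_le_trans aT)// oppr_le0.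
  by rewrite normrN (ger0_norm T0) (ltr0_norm a0) lerNr ltW.
have mna1 : measurable_fun Om1 (fun x => (`|a1 x| `^ 1)%:E).
  by apply: measurable_EFin_powR; exact: measurableT_comp.
have b1L1 : inLp leb Om1 1 b1.
  split; first exact: mb1.
  apply: (le_lt_trans _ a1L1); apply: ge0_le_integral => //.
  - by apply: measurable_EFin_powR; exact: measurableT_comp.
  - by move=> x _; rewrite lee_fin !powRr1.
have H0oo : (\int[leb]_(x in Om1) (h x)%:E < +oo)%E.
  apply: (le_lt_trans _ a1L1); apply: ge0_le_integral => //.
  - by move=> x _; rewrite lee_fin.
  - exact/measurable_EFinP.
  - by move=> x _; rewrite lee_fin powRr1.
have H0_ge0 : (0 <= \int[leb]_(x in Om1) (h x)%:E)%E.
  by apply: integral_ge0 => x _; rewrite lee_fin.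
have H0fin : (\int[leb]_(x in Om1) (h x)%:E)%E \is a fin_num.
  by rewrite ge0_fin_numE.
have WE : (\int[leb]_(y in Om2) (W y)%:E = (C / (T + cdag))%:E)%E.
  under eq_integral do rewrite EFinM.
  rewrite ge0_integralZr//.
  - by rewrite EFinM fineK.
  - exact/measurable_EFinP.
  - by move=> y _; rewrite lee_fin powR_ge0.
  - by rewrite lee_fin invr_ge0 ltW.
have X_ge0 : (0 <= \int[leb \x leb]_(z in Om1 `*` Om2) (oplus_pos c a1 a2 z `^ q)%:E)%E.
  by apply: integral_ge0 => z _; rewrite lee_fin powR_ge0.
have Xfin : (\int[leb \x leb]_(z in Om1 `*` Om2) (oplus_pos c a1 a2 z `^ q)%:E)%E
  \is a fin_num by rewrite ge0_fin_numE.
have mopb := measurable_oplus_pos mOm1 mOm2 mc mb1 ma2.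
have mX := measurable_EFin_powR q mopl.
have mXb := measurable_EFin_powR q mopb.
have mhW : measurable_fun (Om1 `*` Om2) (fun z => h z.1 * W z.2).
  apply: measurable_funM.
  - apply: (@measurable_comp _ _ _ _ _ _ Om1 h) => //.
      by move=> _ [z [Dz _] <-].
    exact: (measurable_funTS measurable_fst).
  - apply: (@measurable_comp _ _ _ _ _ _ Om2 W) => //.
      by move=> _ [z [_ Dz] <-].
    exact: (measurable_funTS measurable_snd).
have mhW' : measurable_fun (Om1 `*` Om2) (fun z => (h z.1 * W z.2)%:E).
  exact/measurable_EFinP.
have mqhW : measurable_fun (Om1 `*` Om2) (fun z => q%:E * (h z.1 * W z.2)%:E)%E.
  by apply/measurable_EFinP/measurable_funM.
have hW0 z : (Om1 `*` Om2) z -> (0 <= (h z.1 * W z.2)%:E)%E.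
  by move=> _; rewrite lee_fin mulr_ge0.
(* The pointwise truncation estimate is integrated; its error term is a product of a function of x
   and one of y, so the integral factorizes. *)
have Xble : (\int[leb \x leb]_(z in Om1 `*` Om2) (oplus_pos c b1 a2 z `^ q)%:E <=
    \int[leb \x leb]_(z in Om1 `*` Om2) (oplus_pos c a1 a2 z `^ q)%:E +
    q%:E * ((\int[leb]_(x in Om1) (h x)%:E) * (C / (T + cdag))%:E))%E.
  rewrite -WE -(ge0_integral_setXM leb leb mOm1 mOm2 mh mW h0 W0).
  rewrite -(ge0_integralZl_EFin _ mOm hW0 mhW' (ltW q0)).
  rewrite -(ge0_integralD _ mOm (fun z _ => _) mX (fun z zOm => _) mqhW); last 2 first.
  - by move=> z; rewrite lee_fin powR_ge0.
  - by move=> z zOm; rewrite mule_ge0 ?hW0// lee_fin ltW.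
  apply: (ge0_le_integral _ mOm _ mXb).
  - by move=> z _; rewrite lee_fin powR_ge0.
  - exact: emeasurable_funD.
  - move=> z zOm; rewrite -EFinM -EFinD lee_fin.
    exact: oplus_pos_truncation_le (hcdag _ zOm).
have Xboo : (\int[leb \x leb]_(z in Om1 `*` Om2) (oplus_pos c b1 a2 z `^ q)%:E < +oo)%E.
  apply: (le_lt_trans Xble); rewrite lte_add_pinfty//.
  by rewrite -(fineK H0fin) -!EFinM ltry.
have Xb_ge0 : (0 <= \int[leb \x leb]_(z in Om1 `*` Om2) (oplus_pos c b1 a2 z `^ q)%:E)%E.
  by apply: integral_ge0 => z _; rewrite lee_fin powR_ge0.
have Xbfin : (\int[leb \x leb]_(z in Om1 `*` Om2) (oplus_pos c b1 a2 z `^ q)%:E)%E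
  \is a fin_num by rewrite ge0_fin_numE.
have admb : Pdag_admissible Om1 Om2 c gamma q b1 a2.
  split; [exact: b1L1|by split; [exact: ma2|exact: a2L1]|].
  exact: (inLp_divrP _ q mOm mopb (oplus_pos_ge0 _ _ _) gam0).2 Xboo.
have mam : measurable_fun Om1 (fun x => a1 x * mu1 x) by exact: measurable_funM.
have mhm : measurable_fun Om1 (fun x => h x * mu1 x) by exact: measurable_funM.
have iam : leb.-integrable Om1 (EFin \o (fun x => a1 x * mu1 x)).
  apply/integrableP; split; first exact/measurable_EFinP.
  by rewrite integral_fin_num_abs.
(* Integrability of [a1 * mu1], known from finiteness of its integral, passes to [h * mu1] through
   |h| <= |a1|. *)
have ihm : leb.-integrable Om1 (EFin \o (fun x => h x * mu1 x)).
  apply: (le_integrable mOm1 _ _ iam); first exact/measurable_EFinP.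
  move=> x _ /=; rewrite lee_fin !normrM ler_wpM2r//.
  by rewrite (ger0_norm (h0 x)).
have Hfin : (\int[leb]_(x in Om1) (h x * mu1 x)%:E)%E \is a fin_num.
  exact: (integrable_fin_num mOm1 ihm).
have I1bE : (\int[leb]_(x in Om1) (b1 x * mu1 x)%:E =
    \int[leb]_(x in Om1) (a1 x * mu1 x)%:E + \int[leb]_(x in Om1) (h x * mu1 x)%:E)%E.
  rewrite -(integralD mOm1 iam ihm); apply: eq_integral => x _ /=.
  by rewrite -EFinD -mulrDl /h addrC subrK.
have dH : (delta%:E * \int[leb]_(x in Om1) (h x)%:E <=
    \int[leb]_(x in Om1) (h x * mu1 x)%:E)%E.
  have mhE : measurable_fun Om1 (fun x => (h x)%:E) by exact/measurable_EFinP.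
  have hE0 x : Om1 x -> (0 <= (h x)%:E)%E by rewrite lee_fin.
  rewrite -(ge0_integralZl_EFin _ mOm1 hE0 mhE (ltW d0)).
  have mhn : measurable_fun Om1 (fun x => `|(h x * mu1 x)%:E|%E).
    by apply: measurableT_comp => //; exact/measurable_EFinP.
  (* The density is nonnegative only a.e.; the absolute value gives an integrand nonnegative
     everywhere, as monotonicity of the integral requires. *)
  have -> : (\int[leb]_(x in Om1) (h x * mu1 x)%:E =
      \int[leb]_(x in Om1) `|(h x * mu1 x)%:E|)%E.
    apply: ae_eq_integral => //; first exact/measurable_EFinP.
    apply: filterS mu1d => x /[apply] dx.
    by rewrite gee0_abs// lee_fin mulr_ge0// (le_trans (ltW d0)).
  apply: ae_ge0_le_integral => //.
  - by move=> x Om1x; rewrite mule_ge0 ?hE0// lee_fin ltW.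
  - by apply/measurable_EFinP/measurable_funM.
  - apply: filterS mu1d => x /[apply] dx.
    have hm0 : 0 <= h x * mu1 x by rewrite mulr_ge0// (le_trans (ltW d0)).
    by rewrite gee0_abs ?lee_fin// mulrC ler_wpM2l.
have H0_eq0 : (\int[leb]_(x in Om1) (h x)%:E = 0)%E.
  have := min _ _ admb; rewrite /Pdag_Lambda I1bE.
  exact: (increment_eq0 q0 g0 wlt Xfin Xbfin I1fin I2fin Hfin H0fin H0_ge0 Xble dH).
(* A nonnegative function of zero integral vanishes a.e., and h = 0 says max(a1, -T) = a1. *)
have : ae_eq leb Om1 (fun x => (h x)%:E) (cst 0%E).
  apply/(ae_eq_integral_abs _ mOm1); first exact/measurable_EFinP.
  rewrite -[RHS]H0_eq0; apply: eq_integral => x _.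
  by rewrite gee0_abs// lee_fin.
apply: filterS => x /[apply] -[] /eqP.
by rewrite /h subr_eq0 /b1 => /eqP <-; rewrite le_max lexx orbT.
Qed.

(** * The L^q bound for the first potential, then for both *)

Lemma Pdag_minimizer_inLp_fst (Om1 Om2 : set (Rn R n))
    (c : Rn R n * Rn R n -> R) (cdag C gamma p q delta : R)
    (mu1 mu2 a1 a2 : Rn R n -> R) :
  measurable Om1 -> measurable Om2 -> measurable_fun (Om1 `*` Om2) c ->
  (forall z, (Om1 `*` Om2) z -> cdag <= c z) ->
  (forall z, (Om1 `*` Om2) z -> c z <= C) ->
  0 < gamma -> 1 < p -> 1 < q -> p^-1 + q^-1 = 1 -> 0 < delta ->
  inLp leb Om1 p mu1 -> inLp leb Om2 p mu2 ->
  {ae leb, forall x, Om1 x -> delta <= mu1 x} ->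
  {ae leb, forall x, Om2 x -> delta <= mu2 x} ->
  (\int[leb]_(x in Om1) (mu1 x)%:E = 1)%E ->
  (\int[leb]_(x in Om2) (mu2 x)%:E = 1)%E ->
  Pdag_minimizer Om1 Om2 c gamma q mu1 mu2 a1 a2 -> inLp leb Om1 q a1.
Proof.
move=> mOm1 mOm2 mc cdagc cC g0 p1 q1 pq d0 mu1Lp mu2Lp mu1d mu2d mu1i mu2i hmin.
have p0 : 0 < p by lra.
have q0 : 0 < q by lra.
(* A null set cannot carry a density of total mass 1. *)
have gt0_dom (Om : set (Rn R n)) (mu : Rn R n -> R) : measurable Om -> inLp leb Om p mu ->
    (\int[leb]_(x in Om) (mu x)%:E = 1)%E -> (0 < leb Om)%E.
  move=> mOm [mmu _] mui; rewrite lt0e measure_ge0 andbT; apply/eqP => Om0.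
  have mmu' : measurable_fun Om (fun x => (mu x)%:E) by exact/measurable_EFinP.
  by have := null_set_integral mOm mmu' Om0; rewrite mui => /eqP; rewrite onee_eq0.
have Om1_gt0 := gt0_dom _ _ mOm1 mu1Lp mu1i.
have Om2_gt0 := gt0_dom _ _ mOm2 mu2Lp mu2i.
have Om1oo := ae_lower_bound_measure_lty mOm1 mu1Lp.1 d0 mu1d mu1i.
have Om2oo := ae_lower_bound_measure_lty mOm2 mu2Lp.1 d0 mu2d mu2i.
(* Stated for generic data because it serves twice: directly for [a2], and for [a1] in the
   transposed problem. *)
have pospart (Om Om' : set (Rn R n)) (c' : Rn R n * Rn R n -> R)
    (a a' : Rn R n -> R) : measurable Om -> measurable Om' ->
    measurable_fun (Om `*` Om') c' -> (0 < leb Om)%E -> (leb Om' < +oo)%E ->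
    (forall z, (Om `*` Om') z -> c' z <= C) ->
    Pdag_admissible Om Om' c' gamma q a a' ->
    (\int[leb]_(y in Om') (Num.max (a' y) 0 `^ q)%:E < +oo)%E.
  move=> mOm mOm' mc' Om_gt0 Omoo c'C [[ma _] [ma' _] opL].
  have mop := measurable_oplus_pos mOm mOm' mc' ma ma'.
  have Xoo := (inLp_divrP _ q (measurableX mOm mOm') mop (oplus_pos_ge0 c' a a') g0).1 opL.
  exact: (oplus_pos_slice_pos_part mOm mOm' mc' ma ma' Om_gt0 Omoo (ltW q0) c'C Xoo).
have adm := hmin.1; case: (adm) => -[ma1 _] [ma2 _] _.
have a2pos := pospart _ _ _ _ _ mOm1 mOm2 mc Om1_gt0 Om2oo cC adm.
have a1pos : (\int[leb]_(y in Om1) (Num.max (a1 y) 0 `^ q)%:E < +oo)%E.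
  have adm' := Pdag_admissible_swap mOm1 mOm2 adm.
  apply: (pospart _ _ _ _ _ mOm2 mOm1 _ Om2_gt0 Om1oo _ adm').
    exact: (measurable_fun_setX_swap mOm1 mOm2 mc).
  by move=> z [Dz1 Dz2]; exact: cC.
have ge0_density (Om : set (Rn R n)) (mu : Rn R n -> R) : {ae leb, forall x, Om x -> delta <= mu x} ->
    {ae leb, forall x, Om x -> 0 <= mu x}.
  by apply: filterS => x /[apply] dx; rewrite (le_trans (ltW d0)).
have I1oo := integral_mulr_ltey mOm1 Om1oo p0 q0 pq ma1 a1pos mu1Lp (ge0_density _ _ mu1d).
have I2oo := integral_mulr_ltey mOm2 Om2oo p0 q0 pq ma2 a2pos mu2Lp (ge0_density _ _ mu2d).
have [I1fin I2fin] := Pdag_minimizer_integrals_fin_num mOm1 mOm2 mc cdagc g0 q0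
  Om2oo mu2Lp.1 mu2i I1oo I2oo hmin.
have [T T0 Ta1] := Pdag_minimizer_ae_bounded_below mOm1 mOm2 mc cdagc g0 q1 d0
  mu1Lp.1 mu1d I1fin I2fin a2pos hmin.
split; first exact: ma1.
(* On the set a1 <= 0 the lower bound gives |a1| <= T; the constant T^q is integrable since [Om1]
   has finite measure. *)
have dom : {ae leb, forall x, Om1 x ->
    `|a1 x| `^ q <= 1 * Num.max (a1 x) 0 `^ q + T `^ q}.
  apply: filterS Ta1 => x /[apply] Ta; rewrite mul1r.
  have [a0|a0] := leP (a1 x) 0.
    rewrite powR0 ?gt_eqF// add0r; apply: ge0_ler_powR; rewrite ?nnegrE//.
      exact: ltW.
    by rewrite ler0_norm// lerNl.
  by rewrite gtr0_norm// lerDl powR_ge0.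
have mn : measurable_fun Om1 (fun x => `|a1 x| `^ q).
  by apply: (measurableT_comp (measurable_powR q)); exact: measurableT_comp.
have mm : measurable_fun Om1 (fun x => Num.max (a1 x) 0 `^ q).
  by apply: (measurableT_comp (measurable_powR q)); exact: measurable_maxr.
exact: (ae_ge0_integral_lty_dominated mOm1 Om1oo mn mm ler01 (powR_ge0 _ _)
  (fun x _ => powR_ge0 _ _) (fun x _ => powR_ge0 _ _) dom a1pos).
Qed.

End problem_P_dagger_minimizers.

Unset Implicit Arguments.

Theorem mainTheorem8 (R : realType) (n : nat)
    (Om1 Om2 : set (Rn R n)) (c : Rn R n * Rn R n -> R)
    (cdag gamma p q delta : R) (mu1 mu2 : Rn R n -> R)
    (hOm1 : compact Om1) (hOm2 : compact Om2)
    (mOm1 : measurable Om1) (mOm2 : measurable Om2)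
    (hc : {within Om1 `*` Om2, continuous c})
    (hcdag : forall z, (Om1 `*` Om2) z -> cdag <= c z)
    (hgamma : 0 < gamma) (hp1 : 1 < p) (hp2 : 2 <= p) (hq : p^-1 + q^-1 = 1)
    (hdelta : 0 < delta)
    (hmu1 : inLp (lebesgue_Rn n) Om1 p mu1)
    (hmu2 : inLp (lebesgue_Rn n) Om2 p mu2)
    (hmu1d : {ae lebesgue_Rn n, forall x, Om1 x -> delta <= mu1 x})
    (hmu2d : {ae lebesgue_Rn n, forall x, Om2 x -> delta <= mu2 x})
    (hmu1i : (\int[lebesgue_Rn n]_(x in Om1) (mu1 x)%:E = 1)%E)
    (hmu2i : (\int[lebesgue_Rn n]_(x in Om2) (mu2 x)%:E = 1)%E)
    (a1 a2 : Rn R n -> R)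
    (hmin : Pdag_minimizer Om1 Om2 c gamma q mu1 mu2 a1 a2) :
  inLp (lebesgue_Rn n) Om1 q a1 /\ inLp (lebesgue_Rn n) Om2 q a2.
Proof.
have pV : p^-1 < 1 by rewrite invf_lt1//; lra.
have pV0 : 0 < p^-1 by rewrite invr_gt0; lra.
have q_gt0 : 0 < q by rewrite -invr_gt0; lra.
have q1 : 1 < q by rewrite -(invf_lt1 q_gt0); lra.
have mc : measurable_fun (Om1 `*` Om2) c.
  exact: within_continuous_measurable_fun (measurableX mOm1 mOm2) hc.
(* The image of the compact product is bounded. Boundedness gives a bound for each number strictly
   above [M], hence the choice [M + 1]. *)
have [C cC] : exists C, forall z, (Om1 `*` Om2) z -> c z <= C.
  have /compact_bounded[M [_ cM]] := continuous_compact hc (compact_setX hOm1 hOm2).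
  exists (M + 1) => z Omz; apply: (le_trans (ler_norm _)).
  by apply: (cM (M + 1)); [rewrite ltrDl|exists z].
split.
  exact: (Pdag_minimizer_inLp_fst mOm1 mOm2 mc hcdag cC hgamma hp1 q1 hq hdelta
    hmu1 hmu2 hmu1d hmu2d hmu1i hmu2i hmin).
(* The second potential is the first one of the transposed problem, whose cost has the same bounds
   [cdag] and [C]. *)
apply: (Pdag_minimizer_inLp_fst (C := C) mOm2 mOm1
  (measurable_fun_setX_swap mOm1 mOm2 mc) _ _ hgamma hp1 q1 hq hdelta
  hmu2 hmu1 hmu2d hmu1d hmu2i hmu1i (Pdag_minimizer_swap mOm1 mOm2 mc hmin)).
- by move=> z [Dz1 Dz2]; exact: hcdag.
- by move=> z [Dz1 Dz2]; exact: cC.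
Qed.
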